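(* Let $g:\mathbb{R}^n\to\mathbb{R}^s$ be $C^2$, $D\subset\mathbb{R}^s$ closed, $\Gamma=g^{-1}(D)$, $\bar x\in\Gamma$, and assume (A1), (A2). Let $\bar x^*\in\hat N_\Gamma(\bar x)$ and let $\bar\lambda$ be the unique vector with $\bar\lambda\in\hat N_D(g(\bar x))$, $\nabla g(\bar x)^T\bar\lambda=\bar x^*$. Then $$\hat N_{\operatorname{gph}\hat N_\Gamma}(\bar x,\bar x^* )=\Big\{(w^*,w)\ \Big|\ \exists v^*\in\mathbb{R}^s:\ (v^*,\nabla g(\bar x)w)\in\hat N_{\operatorname{gph}\hat N_D}(g(\bar x),\bar\lambda),\ w^*=-\nabla^2\langle\bar\lambda,g\rangle(\bar x)w+\nabla g(\bar x)^Tv^*\Big\}.$$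
   Context: Standing assumptions (A1), (A2) for $g:\mathbb{R}^n\to\mathbb{R}^s$ ($C^2$), closed $D\subset\mathbb{R}^s$, $\Gamma=g^{-1}(D)$, $\bar x\in\Gamma$: (A1) There exist a closed set $\Theta\subset\mathbb{R}^d$, a twice continuously differentiable mapping $h:\mathbb{R}^s\to\mathbb{R}^d$ and a neighborhood $\mathcal V$ of $g(\bar x)$ such that $\nabla h(g(\bar x))$ is surjective and $D\cap\mathcal V=\{z\in\mathcal V\mid h(z)\in\Theta\}$. (A2) $\operatorname{range}\nabla g(\bar x)+\ker\nabla h(g(\bar x))=\mathbb{R}^s$. Tangent cone $T_A(\bar a)=\limsup_{t\searrow0}(A-\bar a)/t$; regular normal cone $\hat N_A(\bar a)=(T_A(\bar a))^\circ$, with $\hat N_A(a)=\emptyset$ for $a\notin A$. $\operatorname{gph}F$ is the graph of $F$. $\nabla^2\langle\lambda,g\rangle(x)$ is the Hessian of $x\mapsto\langle\lambda,g(x)\rangle$. *)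

(* Defs.v *)
From Stdlib Require Import Reals.
From mathcomp Require Import all_boot.
Set Implicit Arguments.
Unset Strict Implicit.
Unset Printing Implicit Defensive.
Local Open Scope R_scope.

Definition Vec (n : nat) := 'I_n -> R.
Definition Mat (m n : nat) := 'I_m -> 'I_n -> R.

Definition vadd n (x y : Vec n) : Vec n := fun i => x i + y i.
Definition vscal n (t : R) (x : Vec n) : Vec n := fun i => t * x i.
Definition vsub n (x y : Vec n) : Vec n := fun i => x i - y i.
Definition vopp n (x : Vec n) : Vec n := fun i => - x i.
Definition dot n (x y : Vec n) : R := \big[Rplus/0]_(i < n) (x i * y i).
Definition vnorm n (x : Vec n) : R := sqrt (dot x x).

Definition mv m n (A : Mat m n) (x : Vec n) : Vec m :=
  fun i => \big[Rplus/0]_(j < n) (A i j * x j).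
Definition mtv m n (A : Mat m n) (y : Vec m) : Vec n :=
  fun j => \big[Rplus/0]_(i < m) (A i j * y i).

Definition padd n m (p q : Vec n * Vec m) : Vec n * Vec m :=
  (vadd p.1 q.1, vadd p.2 q.2).
Definition pscal n m (t : R) (p : Vec n * Vec m) : Vec n * Vec m :=
  (vscal t p.1, vscal t p.2).
Definition pdot n m (p q : Vec n * Vec m) : R := dot p.1 q.1 + dot p.2 q.2.

Definition tcone (X : Type) (add : X -> X -> X) (scal : R -> X -> X)
  (ip : X -> X -> R) (A : X -> Prop) (a w : X) : Prop :=
  exists (t : nat -> R) (wk : nat -> X),
    (forall k, 0 < t k) /\ Un_cv t 0 /\
    Un_cv (fun k => sqrt (ip (add (wk k) (scal (-1) w))
                             (add (wk k) (scal (-1) w)))) 0 /\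
    (forall k, A (add a (scal (t k) (wk k)))).

Definition ncone (X : Type) (add : X -> X -> X) (scal : R -> X -> X)
  (ip : X -> X -> R) (A : X -> Prop) (a v : X) : Prop :=
  A a /\ forall w, tcone add scal ip A a w -> ip v w <= 0.

Definition Tc n (A : Vec n -> Prop) (a w : Vec n) := tcone (@vadd n) (@vscal n) (@dot n) A a w.
Definition Nc n (A : Vec n -> Prop) (a v : Vec n) := ncone (@vadd n) (@vscal n) (@dot n) A a v.
Definition Ncp n m (A : Vec n * Vec m -> Prop) (a v : Vec n * Vec m) :=
  ncone (@padd n m) (@pscal n m) (@pdot n m) A a v.

Definition gphNc n (A : Vec n -> Prop) : Vec n * Vec n -> Prop :=
  fun p => Nc A p.1 p.2.

Definition is_closed_set n (A : Vec n -> Prop) : Prop :=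
  forall x, (forall eps, 0 < eps -> exists y, A y /\ vnorm (vsub y x) < eps) -> A x.
Definition nbhd n (V : Vec n -> Prop) (z : Vec n) : Prop :=
  exists r, 0 < r /\ forall y, vnorm (vsub y z) < r -> V y.

Definition frechet n m (f : Vec n -> Vec m) (x : Vec n) (A : Mat m n) : Prop :=
  forall eps, 0 < eps -> exists del, 0 < del /\ forall y,
    vnorm (vsub y x) < del ->
    vnorm (vsub (vsub (f y) (f x)) (mv A (vsub y x))) <= eps * vnorm (vsub y x).

(* f is C^2 with Jacobian Df and second derivative D2f, where
   D2f x i j k = d/dx_k (d f_i / d x_j)(x), and D2f is continuous. *)
Definition C2_with n m (f : Vec n -> Vec m) (Df : Vec n -> Mat m n)
  (D2f : Vec n -> 'I_m -> 'I_n -> 'I_n -> R) : Prop :=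
  (forall x, frechet f x (Df x)) /\
  (forall x (i : 'I_m), frechet (fun y => fun j => Df y i j) x (fun j k => D2f x i j k)) /\
  (forall x i j k eps, 0 < eps -> exists del, 0 < del /\ forall y,
      vnorm (vsub y x) < del -> Rabs (D2f y i j k - D2f x i j k) < eps).

Definition hess_lag n m (D2f : Vec n -> 'I_m -> 'I_n -> 'I_n -> R)
  (lam : Vec m) (x : Vec n) : Mat n n :=
  fun j k => \big[Rplus/0]_(i < m) (lam i * D2f x i j k).

(* Main.v *)
Require Import Defs.
From Stdlib Require Import Reals.
From mathcomp Require Import all_boot.
From HB Require Import structures.
From Stdlib Require Import Lra Lia FunctionalExtensionality IndefiniteDescription.
From Coquelicot Require Import Coquelicot.

(** Put f = h o g. Near the base points D = h^-1(Theta) and Gamma = f^-1(Theta), and (A1), (A2) make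
both derivatives surjective there. So it is enough to treat a preimage of Theta under a map f with
surjective derivative, and to apply this twice: the Hessian of <mu, h o g> is
Dg^T (Hess <mu, h>) Dg + Hess <Dh^T mu, g>, and eliminating the normal vector to gph N_Theta from the
two formulas gives the theorem.

For such a preimage, a Lyusternik-Graves argument gives T_Gamma(x) = Df(x)^-1 T_Theta(f x) and
N_Gamma(x) = Df(x)^T N_Theta(f x) for all x near the base point. Differentiating Df(x)^T mu, the tangent
cone to gph N_Gamma is the set of pairs (u, H u + Df^T eta) with (Df u, eta) tangent to gph N_Theta,
where H is the Hessian of <mu, f>; the multipliers converge because Df has a right inverse. Polarity
and the symmetry of H give the regular normal cone. *)

Set Implicit Arguments.
Local Open Scope R_scope.

(** * Finite sums of real numbers *)

HB.instance Definition _ := Monoid.isComLaw.Build R 0 Rplus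
  (fun x y z => esym (Rplus_assoc x y z)) Rplus_comm Rplus_0_l.
HB.instance Definition _ := Monoid.isMulLaw.Build R 0 Rmult Rmult_0_l Rmult_0_r.
HB.instance Definition _ := Monoid.isAddLaw.Build R Rmult Rplus
  Rmult_plus_distr_r Rmult_plus_distr_l.

Notation rsum n F := (\big[Rplus/0]_(i < n) F i).

Lemma rsum_le n (F G : 'I_n -> R) : (forall i, F i <= G i) -> rsum n F <= rsum n G.
Proof.
move=> H; elim/big_ind2: _ => [|x1 x2 y1 y2 H1 H2|i _] //; [exact: Rle_refl|exact: Rplus_le_compat].
Qed.

Lemma rsum_ge0 n (F : 'I_n -> R) : (forall i, 0 <= F i) -> 0 <= rsum n F.
Proof. by move=> H; elim/big_ind: _ => [|x y H1 H2|j _] //; [exact: Rle_refl|exact: Rplus_le_le_0_compat]. Qed.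

Lemma Rabs_rsum n (F : 'I_n -> R) : Rabs (rsum n F) <= rsum n (fun i => Rabs (F i)).
Proof.
elim/big_ind2: _ => [|x1 x2 y1 y2 H1 H2|i _]; [rewrite Rabs_R0; lra| |lra].
by apply: Rle_trans (Rabs_triang _ _) _; apply: Rplus_le_compat.
Qed.

Lemma rsum_ge_term n (F : 'I_n -> R) (i : 'I_n) : (forall i, 0 <= F i) -> F i <= rsum n F.
Proof.
move=> H; rewrite (bigD1 i) //=.
rewrite -[X in X <= _]Rplus_0_r; apply: Rplus_le_compat_l.
by elim/big_ind: _ => [|x y H1 H2|j _] //; [exact: Rle_refl|exact: Rplus_le_le_0_compat].
Qed.

Lemma rsum_const n (c : R) : \big[Rplus/0]_(i < n) c = INR n * c.
Proof.
elim: n => [|n IH]; first by rewrite big_ord0 /=; ring.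
by rewrite big_ord_recl IH S_INR; ring.
Qed.

Lemma is_lim_seq_rsum n (F : nat -> 'I_n -> R) (L : 'I_n -> R) :
  (forall i, is_lim_seq (fun k => F k i) (L i)) ->
  is_lim_seq (fun k => rsum n (F k)) (rsum n L).
Proof.
elim: n F L => [|n IH] F L H.
  by rewrite big_ord0; apply: (is_lim_seq_ext (fun=> 0)) (is_lim_seq_const 0) => k; rewrite big_ord0.
rewrite big_ord_recl.
apply: (is_lim_seq_ext (fun k => F k ord0 + \big[Rplus/0]_(i < n) F k (lift ord0 i))).
  by move=> k; rewrite big_ord_recl.
apply: is_lim_seq_plus'; first exact: H.
by apply: (IH (fun k i => F k (lift ord0 i)) (fun i => L (lift ord0 i))).
Qed.

(** * Vectors, matrices, transposes and norms *)

Definition vzero n : Vec n := fun=> 0.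
Arguments vzero : clear implicits.

Ltac vext := apply: functional_extensionality => ?; rewrite /vzero /vadd /vsub /vscal /vopp /=; first [ring | field | idtac].

Definition mmul m n p (A : Mat m n) (B : Mat n p) : Mat m p :=
  fun i j => rsum n (fun l => A i l * B l j).

Lemma dotC n (x y : Vec n) : dot x y = dot y x.
Proof. by apply: eq_bigr => i _; ring. Qed.

Lemma dotDl n (x y z : Vec n) : dot (vadd x y) z = dot x z + dot y z.
Proof. by rewrite /dot -big_split; apply: eq_bigr => i _; rewrite /vadd; apply: Rmult_plus_distr_r. Qed.

Lemma dotZl n t (x z : Vec n) : dot (vscal t x) z = t * dot x z.
Proof. by rewrite /dot big_distrr; apply: eq_bigr => i _; rewrite /vscal /=; ring. Qed.

Lemma vopp_scal n (x : Vec n) : vopp x = vscal (-1) x.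
Proof. by vext. Qed.

Lemma vsubE n (x y : Vec n) : vsub x y = vadd x (vscal (-1) y).
Proof. by vext. Qed.

Lemma dot0l n (x : Vec n) : dot (vzero n) x = 0.
Proof. by rewrite (_ : vzero n = vscal 0 x) ?dotZl; [ring | vext]. Qed.

Lemma dotDr n (x y z : Vec n) : dot z (vadd x y) = dot z x + dot z y.
Proof. by rewrite !(dotC z) dotDl. Qed.

Lemma dotZr n t (x z : Vec n) : dot z (vscal t x) = t * dot z x.
Proof. by rewrite !(dotC z) dotZl. Qed.

Lemma mvE m n (A : Mat m n) x i : mv A x i = dot (A i) x.
Proof. by []. Qed.

Lemma mtvE m n (A : Mat m n) y j : mtv A y j = dot (A^~ j) y.
Proof. by []. Qed.

Lemma mvD m n (A : Mat m n) x y : mv A (vadd x y) = vadd (mv A x) (mv A y).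
Proof. by apply: functional_extensionality => i; rewrite mvE dotDr. Qed.

Lemma mvZ m n (A : Mat m n) t x : mv A (vscal t x) = vscal t (mv A x).
Proof. by apply: functional_extensionality => i; rewrite mvE dotZr. Qed.

Lemma mvB m n (A : Mat m n) x y : mv A (vsub x y) = vsub (mv A x) (mv A y).
Proof. by rewrite !vsubE mvD mvZ. Qed.

Lemma mtvD m n (A : Mat m n) x y : mtv A (vadd x y) = vadd (mtv A x) (mtv A y).
Proof. by apply: functional_extensionality => i; rewrite mtvE dotDr. Qed.

Lemma mtvZ m n (A : Mat m n) t x : mtv A (vscal t x) = vscal t (mtv A x).
Proof. by apply: functional_extensionality => i; rewrite mtvE dotZr. Qed.

Lemma dot_mtv m n (A : Mat m n) y x : dot (mtv A y) x = dot y (mv A x).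
Proof.
rewrite /dot /mtv /mv.
under eq_bigr => j _ do rewrite Rmult_comm big_distrr.
rewrite exchange_big; apply: eq_bigr => i _.
by rewrite [RHS]big_distrr; apply: eq_bigr => j _ /=; ring.
Qed.

Lemma dot_ext n (x y : Vec n) : (forall z, dot x z = dot y z) -> x = y.
Proof.
move=> H; apply: functional_extensionality => i.
have E (v : Vec n) : dot v (fun j => if j == i then 1 else 0) = v i.
  rewrite /dot (bigD1 i) //= eqxx big1 => [|j /negbTE ->]; last by ring.
  by rewrite Rplus_0_r Rmult_1_r.
by rewrite -(E x) -(E y).
Qed.

Lemma mv_mmul m n p (A : Mat m n) (B : Mat n p) x : mv (mmul A B) x = mv A (mv B x).
Proof.
apply: functional_extensionality => i; rewrite /mv /mmul.
under eq_bigr => j _ do rewrite Rmult_comm big_distrr.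
rewrite exchange_big; apply: eq_bigr => l _.
by rewrite [RHS]big_distrr; apply: eq_bigr => j _ /=; ring.
Qed.

Lemma mtv_mmul m n p (A : Mat m n) (B : Mat n p) y : mtv (mmul A B) y = mtv B (mtv A y).
Proof. by apply: dot_ext => z; rewrite !dot_mtv mv_mmul. Qed.

(* The l1 norm replaces the Euclidean one: the triangle inequality and operator bounds come for free. *)
Definition n1 n (x : Vec n) : R := rsum n (fun i => Rabs (x i)).
Definition mnorm m n (A : Mat m n) : R := rsum m (fun i => n1 (A i)).

Lemma n1_ge0 n (x : Vec n) : 0 <= n1 x.
Proof. by apply: rsum_ge0 => i; apply: Rabs_pos. Qed.

Lemma coord_le_n1 n (x : Vec n) i : Rabs (x i) <= n1 x.
Proof. by apply: (@rsum_ge_term n (fun i => Rabs (x i))) => j; apply: Rabs_pos. Qed.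

Lemma n1D n (x y : Vec n) : n1 (vadd x y) <= n1 x + n1 y.
Proof. by rewrite /n1 -big_split; apply: rsum_le => i; apply: Rabs_triang. Qed.

Lemma n1Z n t (x : Vec n) : n1 (vscal t x) = Rabs t * n1 x.
Proof. by rewrite /n1 big_distrr; apply: eq_bigr => i _; apply: Rabs_mult. Qed.

Lemma n1B n (x y : Vec n) : n1 (vsub x y) <= n1 x + n1 y.
Proof.
rewrite vsubE; have := n1D x (vscal (-1) y).
by rewrite n1Z Rabs_Ropp Rabs_R1; lra.
Qed.

Lemma n1C n (x y : Vec n) : n1 (vsub x y) = n1 (vsub y x).
Proof. by apply: eq_bigr => i _; apply: Rabs_minus_sym. Qed.

Lemma n1_triang n (y x z : Vec n) : n1 (vsub x z) <= n1 (vsub x y) + n1 (vsub y z).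
Proof. by rewrite (_ : vsub x z = vadd (vsub x y) (vsub y z)); [apply: n1D | vext]. Qed.

Lemma n1_0 n : n1 (vzero n) = 0.
Proof. by rewrite (_ : vzero n = vscal 0 (vzero n)) ?n1Z ?Rabs_R0; [ring | vext]. Qed.

Lemma n1_eq0 n (x y : Vec n) : n1 (vsub x y) <= 0 -> x = y.
Proof.
move=> H; apply: functional_extensionality => i.
have H2 : Rabs (x i - y i) <= n1 (vsub x y) := coord_le_n1 (vsub x y) i.
by split_Rabs; lra.
Qed.

Lemma n1_le n (x : Vec n) (F : Vec n) : (forall i, Rabs (x i) <= F i) -> n1 x <= rsum n F.
Proof. exact: rsum_le. Qed.

Lemma mnorm_ge0 m n (A : Mat m n) : 0 <= mnorm A.
Proof. by apply: rsum_ge0 => i; apply: n1_ge0. Qed.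

Lemma dot_le n (x y : Vec n) : Rabs (dot x y) <= n1 x * n1 y.
Proof.
apply: (Rle_trans _ _ _ (Rabs_rsum _)).
rewrite /n1 [X in _ <= X]big_distrl; apply: rsum_le => i; rewrite Rabs_mult /=.
by apply: Rmult_le_compat_l (Rabs_pos _) _; apply: coord_le_n1.
Qed.

Lemma n1_mv m n (A : Mat m n) x : n1 (mv A x) <= mnorm A * n1 x.
Proof.
rewrite /mnorm big_distrl; apply: n1_le => i; exact: dot_le.
Qed.

Lemma vnorm_ge0 n (x : Vec n) : 0 <= vnorm x.
Proof. exact: sqrt_pos. Qed.

Lemma coord_le_vnorm n (x : Vec n) i : Rabs (x i) <= vnorm x.
Proof.
rewrite -sqrt_Rsqr_abs; apply: sqrt_le_1_alt.
by apply: (@rsum_ge_term n (fun i => x i * x i)) => j; apply: Rle_0_sqr.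
Qed.

Lemma vnorm_le_n1 n (x : Vec n) : vnorm x <= n1 x.
Proof.
rewrite -(sqrt_Rsqr (n1 x)); last exact: n1_ge0.
apply: sqrt_le_1_alt; apply: Rle_trans (Rle_abs _) _; exact: dot_le.
Qed.

Lemma n1_le_vnorm n (x : Vec n) : n1 x <= INR n * vnorm x.
Proof. by rewrite -rsum_const; apply: n1_le => i; apply: coord_le_vnorm. Qed.

(** * Convergence of vectors and matrices *)

Definition vcv n (x : nat -> Vec n) (l : Vec n) :=
  forall i, is_lim_seq (fun k => x k i) (l i).

Lemma vcv_ext n (x y : nat -> Vec n) l : (forall k, x k = y k) -> vcv x l -> vcv y l.
Proof. by move=> E H i; apply: is_lim_seq_ext (H i) => k; rewrite E. Qed.

Lemma vcv_const n (x : Vec n) : vcv (fun=> x) x.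
Proof. by move=> i; apply: is_lim_seq_const. Qed.

Lemma vcvD n (x y : nat -> Vec n) l m : vcv x l -> vcv y m -> vcv (fun k => vadd (x k) (y k)) (vadd l m).
Proof. by move=> H1 H2 i; apply: is_lim_seq_plus'; [apply: H1 | apply: H2]. Qed.

Lemma vcvZ n t (x : nat -> Vec n) (c : R) l : is_lim_seq t c -> vcv x l -> vcv (fun k => vscal (t k) (x k)) (vscal c l).
Proof. by move=> H1 H2 i; apply: is_lim_seq_mult'; [apply: H1 | apply: H2]. Qed.

Lemma vcvB n (x y : nat -> Vec n) l m : vcv x l -> vcv y m -> vcv (fun k => vsub (x k) (y k)) (vsub l m).
Proof. by move=> H1 H2 i; apply: is_lim_seq_minus'; [apply: H1 | apply: H2]. Qed.

Lemma cv_dot n (x y : nat -> Vec n) l m : vcv x l -> vcv y m -> is_lim_seq (fun k => dot (x k) (y k)) (dot l m).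
Proof.
move=> H1 H2; apply: is_lim_seq_rsum => i.
by apply: is_lim_seq_mult'; [apply: H1 | apply: H2].
Qed.

Definition mcv m n (A : nat -> Mat m n) (L : Mat m n) :=
  forall i j, is_lim_seq (fun k => A k i j) (L i j).

Lemma mcv_const m n (A : Mat m n) : mcv (fun=> A) A.
Proof. by move=> i j; apply: is_lim_seq_const. Qed.

Lemma vcv_mv m n (A : nat -> Mat m n) L x l : mcv A L -> vcv x l -> vcv (fun k => mv (A k) (x k)) (mv L l).
Proof. by move=> H1 H2 i; apply: cv_dot. Qed.

Lemma vcv_mtv m n (A : nat -> Mat m n) L x l : mcv A L -> vcv x l -> vcv (fun k => mtv (A k) (x k)) (mtv L l).
Proof. by move=> H1 H2 j; apply: cv_dot => // i; apply: H1. Qed.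

Lemma cv_n1 n (x : nat -> Vec n) l : vcv x l -> is_lim_seq (fun k => n1 (x k)) (n1 l).
Proof.
by move=> H; apply: is_lim_seq_rsum => i; apply: (is_lim_seq_abs _ (l i)).
Qed.

Lemma vcv_n1 n (x : nat -> Vec n) l : is_lim_seq (fun k => n1 (vsub (x k) l)) 0 -> vcv x l.
Proof.
move=> H i.
have : is_lim_seq (fun k => x k i - l i) 0.
  apply/is_lim_seq_abs_0; apply: is_lim_seq_le_le (is_lim_seq_const 0) H => k.
  by split; [apply: Rabs_pos | apply: (coord_le_n1 (vsub (x k) l))].
move=> H2; apply: (is_lim_seq_ext (fun k => (x k i - l i) + l i)); first by move=> k; ring.
by have := is_lim_seq_plus' _ _ _ _ H2 (is_lim_seq_const (l i)); rewrite Rplus_0_l.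
Qed.

Lemma cv_n1_sub n (x : nat -> Vec n) l : vcv x l -> is_lim_seq (fun k => n1 (vsub (x k) l)) 0.
Proof.
move=> /vcvB /(_ (vcv_const l)) /cv_n1.
by rewrite (_ : vsub l l = vzero n) ?n1_0; [|vext].
Qed.

Lemma vcv_unique n (x : nat -> Vec n) l m : vcv x l -> vcv x m -> l = m.
Proof.
move=> H1 H2; apply: functional_extensionality => i.
by have := is_lim_seq_unique _ _ (H1 i); rewrite (is_lim_seq_unique _ _ (H2 i)); case.
Qed.

(** [n1] lies between [vnorm] and [INR n * vnorm], so the Euclidean limits in the definitions of the
    cones can be traded for coordinatewise ones. *)
Lemma cv_vnorm n (x : nat -> Vec n) l :
  is_lim_seq (fun k => vnorm (vsub (x k) l)) 0 <-> vcv x l.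
Proof.
split=> [H|/cv_n1_sub H].
  apply: vcv_n1; apply: is_lim_seq_le_le (is_lim_seq_const 0) _.
    by move=> k; split; [apply: n1_ge0 | apply: n1_le_vnorm].
  by have := is_lim_seq_scal_l _ (INR n) _ H; rewrite /= Rmult_0_r.
apply: is_lim_seq_le_le (is_lim_seq_const 0) H => k.
by split; [apply: vnorm_ge0 | apply: vnorm_le_n1].
Qed.

(** * Tangent cones described by sequences *)

Lemma TcP n (A : Vec n -> Prop) a w : Tc A a w <->
  exists t u, (forall k, 0 < t k) /\ is_lim_seq t 0 /\ vcv u w /\
    forall k, A (vadd a (vscal (t k) (u k))).
Proof.
have E (u : nat -> Vec n) : is_lim_seq (fun k => sqrt (dot (vadd (u k) (vscal (-1) w))
     (vadd (u k) (vscal (-1) w)))) 0 <-> vcv u w.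
  by rewrite -cv_vnorm; split; apply: is_lim_seq_ext => k; rewrite /vnorm vsubE.
split=> -[t [u [t0 [tl [ul H]]]]]; exists t, u; do ! split => //.
- exact/is_lim_seq_Reals.
- by apply/E/is_lim_seq_Reals.
- exact/is_lim_seq_Reals.
- by apply/is_lim_seq_Reals/E.
Qed.

Definition Tcp n m (A : Vec n * Vec m -> Prop) a w :=
  tcone (@padd n m) (@pscal n m) (@pdot n m) A a w.

(** The norm of a pair dominates the norm of each component and is at most their sum, so pairs
    converge exactly when both components do. *)
Lemma TcpP n m (A : Vec n * Vec m -> Prop) a a' w w' : Tcp A (a, a') (w, w') <->
  exists t u u', (forall k, 0 < t k) /\ is_lim_seq t 0 /\ vcv u w /\ vcv u' w' /\
    forall k, A (vadd a (vscal (t k) (u k)), vadd a' (vscal (t k) (u' k))).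
Proof.
pose N (x : Vec n) (y : Vec m) := sqrt (dot x x + dot y y).
have E (u : nat -> Vec n * Vec m) : is_lim_seq (fun k => sqrt (pdot (padd (u k) (pscal (-1) (w, w')))
     (padd (u k) (pscal (-1) (w, w'))))) 0 <->
     vcv (fun k => (u k).1) w /\ vcv (fun k => (u k).2) w'.
  have dot_ge0 p (x : Vec p) : 0 <= dot x x by apply: rsum_ge0 => i; apply: Rle_0_sqr.
  rewrite -!cv_vnorm.
  have E1 k : sqrt (pdot (padd (u k) (pscal (-1) (w, w'))) (padd (u k) (pscal (-1) (w, w')))) =
      N (vsub (u k).1 w) (vsub (u k).2 w') by rewrite /N !vsubE.
  split=> [H|[/is_lim_seq_plus' H1 /H1 H2]].
    split; apply: is_lim_seq_le_le (is_lim_seq_const 0) H => k; rewrite E1; split;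
      try exact: vnorm_ge0; apply: sqrt_le_1_alt.
      by have := dot_ge0 _ (vsub (u k).2 w'); lra.
    by have := dot_ge0 _ (vsub (u k).1 w); lra.
  rewrite Rplus_0_l in H2; apply: is_lim_seq_le_le (is_lim_seq_const 0) H2 => k.
  rewrite E1; split; first exact: sqrt_pos.
  set x := vsub _ _; set y := vsub _ _.
  rewrite -(sqrt_Rsqr (vnorm x + vnorm y)); last first.
    by have := vnorm_ge0 x; have := vnorm_ge0 y; lra.
  apply: sqrt_le_1_alt; rewrite /Rsqr.
  have := sqrt_sqrt _ (dot_ge0 _ x); have := sqrt_sqrt _ (dot_ge0 _ y).
  rewrite -/(vnorm x) -/(vnorm y).
  by have := vnorm_ge0 x; have := vnorm_ge0 y; nra.
split=> [[t [u [t0 [tl [/is_lim_seq_Reals/E [ul ul'] H]]]]]|[t [u [u' [t0 [tl [ul [ul' H]]]]]]]].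
  exists t, (fun k => (u k).1), (fun k => (u k).2); do ! split => //.
  exact/is_lim_seq_Reals.
exists t, (fun k => (u k, u' k)); do ! split => //.
- exact/is_lim_seq_Reals.
- by apply/is_lim_seq_Reals/E.
Qed.

Lemma vcv_shift n (x : nat -> Vec n) l N : vcv x l -> vcv (fun k => x (k + N)%coq_nat) l.
Proof. by move=> H i; apply/(is_lim_seq_incr_n (fun k => x k i)). Qed.

(** Dropping the first [N] terms preserves positivity and limits. Local arguments give membership
    only for large [k], and this makes that enough. *)
Lemma Tc_eventually n (A : Vec n -> Prop) a w t u :
  (forall k, 0 < t k) -> is_lim_seq t 0 -> vcv u w ->
  eventually (fun k => A (vadd a (vscal (t k) (u k)))) -> Tc A a w.
Proof.
move=> t0 tl ul [N HN]; apply/TcP.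
exists (fun k => t (k + N)%coq_nat), (fun k => u (k + N)%coq_nat); do ! split => //.
- exact/(is_lim_seq_incr_n t).
- exact: vcv_shift.
- by move=> k; apply: HN; lia.
Qed.

Lemma Tcp_eventually n m (A : Vec n * Vec m -> Prop) a a' w w' t u u' :
  (forall k, 0 < t k) -> is_lim_seq t 0 -> vcv u w -> vcv u' w' ->
  eventually (fun k => A (vadd a (vscal (t k) (u k)), vadd a' (vscal (t k) (u' k)))) ->
  Tcp A (a, a') (w, w').
Proof.
move=> t0 tl ul ul' [N HN]; apply/TcpP.
exists (fun k => t (k + N)%coq_nat), (fun k => u (k + N)%coq_nat), (fun k => u' (k + N)%coq_nat).
do ! split => //.
- exact/(is_lim_seq_incr_n t).
- exact: vcv_shift.
- exact: vcv_shift.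
- by move=> k; apply: HN; lia.
Qed.

(** Below the threshold [N] nothing is asked of [u]; the default [x0] fills these indices. *)
Lemma eventually_choice (T : Type) (x0 : T) (P : nat -> T -> Prop) :
  eventually (fun k => exists x, P k x) ->
  exists u, eventually (fun k => P k (u k)).
Proof.
move=> [N HN].
have [k|u Hu] := functional_choice (fun k x => (N <= k)%coq_nat -> P k x); last by exists u, N.
by case: (PeanoNat.Nat.le_gt_cases N k) => [/HN [x Hx]|kN]; [exists x | exists x0; lia].
Qed.

Lemma vcv_eventually n (x : nat -> Vec n) l eps : vcv x l -> 0 < eps ->
  eventually (fun k => n1 (vsub (x k) l) < eps).
Proof.
move=> /cv_n1_sub /is_lim_seq_spec H e0.
apply: filter_imp (H (mkposreal _ e0)) => k /=.
by rewrite Rminus_0_r => H2; apply: Rle_lt_trans (Rle_abs _) H2.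
Qed.

Lemma vcv_ext_loc n (x y : nat -> Vec n) l :
  eventually (fun k => x k = y k) -> vcv x l -> vcv y l.
Proof.
move=> E H i; apply: is_lim_seq_ext_loc (H i).
by apply: filter_imp E => k ->.
Qed.

Lemma vcv_step n (x : Vec n) t u w : is_lim_seq t 0 -> vcv u w ->
  vcv (fun k => vadd x (vscal (t k) (u k))) x.
Proof.
move=> tl ul; rewrite -[X in vcv _ X](_ : vadd x (vscal 0 w) = x); last by vext.
by apply: vcvD; [apply: vcv_const | apply: vcvZ].
Qed.

Lemma step_near n (x xb : Vec n) t u w r : is_lim_seq t 0 -> vcv u w ->
  n1 (vsub x xb) < r ->
  eventually (fun k => n1 (vsub (vadd x (vscal (t k) (u k))) xb) < r).
Proof.
move=> tl ul xr; have Hr : 0 < r - n1 (vsub x xb) by lra.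
apply: filter_imp (vcv_eventually (vcv_step x tl ul) Hr) => k H.
by have := n1_triang x (vadd x (vscal (t k) (u k))) xb; lra.
Qed.

Definition tseq (k : nat) := / (INR k + 1).

Lemma tseq_gt0 k : 0 < tseq k.
Proof. by apply: Rinv_0_lt_compat; have := pos_INR k; lra. Qed.

Lemma tseq_cv : is_lim_seq tseq 0.
Proof.
apply: (is_lim_seq_inv _ p_infty) => //.
apply: (is_lim_seq_plus _ _ p_infty 1 p_infty) => //; [exact: is_lim_seq_INR | exact: is_lim_seq_const].
Qed.

Lemma Tcp0 n m (A : Vec n * Vec m -> Prop) a a' : A (a, a') -> Tcp A (a, a') (vzero n, vzero m).
Proof.
move=> H; apply/TcpP; exists tseq, (fun=> vzero n), (fun=> vzero m).
do ! split; [exact: tseq_gt0|exact: tseq_cv|exact: vcv_const|exact: vcv_const|].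
by move=> k; rewrite !(_ : forall p (b : Vec p), vadd b (vscal (tseq k) (vzero p)) = b) // => p b; vext.
Qed.

Lemma Tc0 n (A : Vec n -> Prop) a : A a -> Tc A a (vzero n).
Proof.
move=> H; apply/TcP; exists tseq, (fun=> vzero n).
do ! split; [exact: tseq_gt0|exact: tseq_cv|exact: vcv_const|].
by move=> k; rewrite (_ : vadd a _ = a) //; vext.
Qed.

(** * Hadamard and strict derivatives *)

(** The directions [u k] may move with [k], exactly as in the sequences that define tangent vectors.
    [L] is a plain map, so that composed expressions can serve as derivatives without being
    assembled into one matrix. *)
Definition hadamard n m (f : Vec n -> Vec m) x (L : Vec n -> Vec m) :=
  forall t u w, (forall k, 0 < t k) -> is_lim_seq t 0 -> vcv u w ->
  vcv (fun k => vscal (/ t k) (vsub (f (vadd x (vscal (t k) (u k)))) (f x))) (L w).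

Definition lin_err n m (f : Vec n -> Vec m) (A : Mat m n) a b :=
  n1 (vsub (vsub (f a) (f b)) (mv A (vsub a b))).

(** Both [a] and [b] move, which is the uniformity that a Newton iteration with frozen derivative
    needs. *)
Definition strict_diff n m (f : Vec n -> Vec m) x (A : Mat m n) :=
  forall eps, 0 < eps -> exists del, 0 < del /\ forall a b,
    n1 (vsub a x) < del -> n1 (vsub b x) < del ->
    lin_err f A a b <= eps * n1 (vsub a b).

Lemma lin_err_lip n m (f : Vec n -> Vec m) A a b eps :
  lin_err f A a b <= eps * n1 (vsub a b) ->
  n1 (vsub (f a) (f b)) <= (eps + mnorm A) * n1 (vsub a b).
Proof.
rewrite /lin_err => H.
have := n1D (vsub (vsub (f a) (f b)) (mv A (vsub a b))) (mv A (vsub a b)).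
rewrite (_ : vadd _ _ = vsub (f a) (f b)); last by vext.
by have := n1_mv A (vsub a b); nra.
Qed.

(** * Right inverses and the Lyusternik-Graves theorem *)

Lemma surj_rinv m n (A : Mat m n) : (forall y, exists z, mv A z = y) ->
  exists B : Mat n m, forall y, mv A (mv B y) = y.
Proof.
move=> H.
have [z Hz] := functional_choice (fun (j : 'I_m) z => mv A z = fun i => if i == j then 1 else 0)
  (fun j => H _).
exists (fun l j => z j l) => y; rewrite -mv_mmul; apply: functional_extensionality => i.
rewrite /mv (bigD1 i) //= big1 => [|j /negbTE ji]; rewrite /mmul -/(mv A (z _) i) Hz.
  by rewrite eqxx; ring.
by rewrite eq_sym ji; ring.
Qed.

(** The kernel contains [-w] along with [w], so the inequality is an equality there. Since
    [z - B A z] lies in the kernel, [x] takes the same value at [z] and at [B A z]. *)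
Lemma ker_orth_range m n (A : Mat m n) (B : Mat n m) (x : Vec n) :
  (forall y, mv A (mv B y) = y) ->
  (forall w, mv A w = vzero m -> dot x w <= 0) -> x = mtv A (mtv B x).
Proof.
move=> AB H; have H0 w : mv A w = vzero m -> dot x w = 0.
  move=> Aw; apply: Rle_antisym; first exact: H.
  have /H : mv A (vscal (-1) w) = vzero m by rewrite mvZ Aw; vext.
  by rewrite dotZr; lra.
apply: dot_ext => z; rewrite !dot_mtv.
have /H0 : mv A (vsub z (mv B (mv A z))) = vzero m by rewrite mvB AB; vext.
by rewrite vsubE dotDr dotZr; lra.
Qed.

(* Newton iteration with the derivative frozen at x0: the residual is at least halved in each step. *)
Lemma graves m n (f : Vec n -> Vec m) x0 (A : Mat m n) (B : Mat n m) del :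
  (forall y, mv A (mv B y) = y) ->
  (forall a b, n1 (vsub a x0) < del -> n1 (vsub b x0) < del ->
     lin_err f A a b <= / (2 * (mnorm B + 1)) * n1 (vsub a b)) ->
  forall p y, n1 (vsub p x0) + mnorm B * (2 * n1 (vsub y (f p))) < del ->
  exists c, f (vadd p (mv B c)) = y /\ n1 c <= 2 * n1 (vsub y (f p)).
Proof.
move=> AB Hf p y; set R0 := n1 (vsub y (f p)) => Hp.
have K0 := mnorm_ge0 B; set K := mnorm B in K0 Hf Hp *.
have R00 : 0 <= R0 by apply: n1_ge0.
pose q c := vadd p (mv B c).
pose res c := vsub y (f (q c)).
pose cs := fix cs k := if k is k'.+1 then vadd (cs k') (res (cs k')) else vzero m.
(* Every correction of size at most [2 * R0] keeps [q c] inside the ball where the linearisation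
   estimate holds. *)
have near c : n1 c <= 2 * R0 -> n1 (vsub (q c) x0) < del.
  move=> Hc; rewrite (_ : vsub (q c) x0 = vadd (vsub p x0) (mv B c)); last by rewrite /q; vext.
  by have := n1D (vsub p x0) (mv B c); have := n1_mv B c; rewrite -/K; nra.
have q0 : q (vzero m) = p.
  rewrite /q (_ : vzero m = vscal 0 (vzero m)) ?mvZ; vext.
(* The second bound sums the geometric series of the first. *)
have inv k : n1 (res (cs k)) <= R0 * (/2)^k /\ n1 (cs k) <= 2 * R0 * (1 - (/2)^k).
  elim: k => [|k [H1 H2]]; first by rewrite /= /res q0 -/R0 n1_0; lra.
  have P : 0 < (/2)^k by apply: pow_lt; lra.
  set e := (/2)^k in P H1 H2.
  have E : (/2)^k.+1 = e / 2 by rewrite /= -/e; field.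
  rewrite E [cs k.+1]/=; set c := cs k in H1 H2 *; set c' := vadd c (res c).
  have Hc' : n1 c' <= 2 * R0 * (1 - e / 2) by have := n1D c (res c); rewrite -/c'; lra.
  split=> //.
  have := Hf (q c') (q c) (near c' ltac:(nra)) (near c ltac:(nra)).
  have Ed : vsub (q c') (q c) = mv B (res c) by rewrite /q /c' mvD; vext.
  rewrite /lin_err Ed AB.
  (* Because [A B] is the identity, the linearisation error of the step is the new residual up to
     sign. *)
  rewrite n1C (_ : vsub (res c) _ = res c'); last by rewrite /res; vext.
  have := n1_mv B (res c); rewrite -/K => H3 H4.
  have I0 : 0 < / (2 * (K + 1)) by apply: Rinv_0_lt_compat; lra.
  have I1 : / (2 * (K + 1)) * K <= / 2.
    by apply: (Rmult_le_reg_l (2 * (K + 1))); [lra | field_simplify; lra].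
  have := n1_ge0 (res c); set r := n1 (res c) in H1 H3 *.
  by move=> r0; nra.
(* The increments of [cs] are the residuals, dominated by a geometric series. As [cs] starts at
   zero, the partial sum up to [k] is [cs k.+1]. *)
have [c Hc] : exists c, vcv cs c.
  exists (fun i => real (Lim_seq (fun k => cs k i))) => i.
  apply: Lim_seq_correct'.
  have [l Hl] : ex_series (fun k => res (cs k) i).
    apply: (ex_series_le _ (fun k => R0 * (/2)^k)).
      by move=> k; apply: Rle_trans (coord_le_n1 _ _) (proj1 (inv k)).
    apply: (ex_series_scal_l R0 (fun k => (/2)^k)); apply: ex_series_geom.
    by rewrite Rabs_pos_eq; lra.
  exists l; apply/is_lim_seq_incr_1.
  apply: is_lim_seq_ext (Hl : is_lim_seq _ l) => k.
  elim: k => [|k IH]; first by rewrite sum_O /= /vadd /vzero; ring.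
  by rewrite sum_Sn IH.
have Hc2 : n1 c <= 2 * R0.
  apply: (is_lim_seq_le _ _ (n1 c) (2 * R0) _ (cv_n1 Hc) (is_lim_seq_const _)) => k.
  have [_] := inv k; have P : 0 < (/2)^k by apply: pow_lt; lra.
  by nra.
have cnear := near c Hc2.
exists c; split=> //; apply/esym/n1_eq0; rewrite -/(q c).
set e := / _ in Hf.
have e0 : 0 < e by apply: Rinv_0_lt_compat; lra.
pose M := e + mnorm A.
(* The residual at the limit is at most the residual of [cs k] plus a Lipschitz bound for [f]
   between the two points; both tend to zero. *)
have lim1 : is_lim_seq (fun k => R0 * (/2)^k + M * n1 (vsub (q (cs k)) (q c))) (R0 * 0 + M * 0).
  apply: is_lim_seq_plus'; apply: is_lim_seq_mult'; try exact: is_lim_seq_const.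
    by apply: is_lim_seq_geom; rewrite Rabs_pos_eq; lra.
  apply: cv_n1_sub; apply: vcvD; first exact: vcv_const.
  by apply: vcv_mv => //; exact: mcv_const.
rewrite (_ : R0 * 0 + M * 0 = 0) in lim1; last by ring.
apply: (is_lim_seq_le _ _ (n1 (vsub y (f (q c)))) 0 _ (is_lim_seq_const _) lim1) => k.
have [H1 H2] := inv k.
have knear : n1 (vsub (q (cs k)) x0) < del.
  apply: near; have P : 0 < (/2)^k by apply: pow_lt; lra.
  by nra.
have := lin_err_lip (Hf _ _ knear cnear); rewrite -/M => H3.
have := n1_triang (f (q (cs k))) y (f (q c)); rewrite -/(res (cs k)).
by lra.
Qed.

Lemma mv0 m n (A : Mat m n) : mv A (vzero n) = vzero m.
Proof. by rewrite (_ : vzero n = vscal 0 (vzero n)) ?mvZ; vext. Qed.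

(** [graves] is applied to the linear map [L] with [A] as approximate derivative. The estimate is
    global, so the radius may be chosen after [y], large enough to reach it. *)
Lemma perturb_surj m n (A L : Mat m n) (B : Mat n m) :
  (forall y, mv A (mv B y) = y) ->
  (forall u, n1 (vsub (mv L u) (mv A u)) <= / (2 * (mnorm B + 1)) * n1 u) ->
  exists B', forall y, mv L (mv B' y) = y.
Proof.
move=> AB H; apply: surj_rinv => y.
have [||c [Hc _]] := @graves m n (mv L) (vzero n) A B
  (mnorm B * (2 * n1 y) + 1) AB _ (vzero n) y.
- by move=> a b _ _; rewrite /lin_err -mvB; apply: H.
- have E p (x : Vec p) : vsub x (vzero p) = x by vext.
  by rewrite mv0 !E n1_0; lra.
- by eexists; exact: Hc.
Qed.

(** In the strict estimate at [xb], take [a = x + t u] and [b = x], divide by [t] and let [t] tend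
    to zero: the quotient tends to [Df x u]. *)
Lemma strict_diff_deriv m n (f : Vec n -> Vec m) (Df : Vec n -> Mat m n) xb :
  (forall x, hadamard f x (mv (Df x))) -> strict_diff f xb (Df xb) ->
  forall eps, 0 < eps -> exists del, 0 < del /\ forall x, n1 (vsub x xb) < del ->
    forall u, n1 (vsub (mv (Df x) u) (mv (Df xb) u)) <= eps * n1 u.
Proof.
move=> Hd Hs eps /Hs [del [d0 H]]; exists del; split=> // x xd u.
have L := vcvB (Hd x _ _ _ tseq_gt0 tseq_cv (vcv_const u)) (vcv_const (mv (Df xb) u)).
have := cv_n1 L; set l := n1 _; move=> L1.
apply: (is_lim_seq_le_loc _ _ l (eps * n1 u) _ L1 (is_lim_seq_const _)).
apply: filter_imp (step_near tseq_cv (vcv_const u) xd) => k Hk.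
have := H _ _ Hk xd; rewrite /lin_err.
have t0 := tseq_gt0 k; set t := tseq k in t0 *.
have -> : vsub (vadd x (vscal t u)) x = vscal t u by vext.
rewrite mvZ n1Z Rabs_pos_eq => [H2|]; last lra.
have -> : vsub (vscal (/ t) (vsub (f (vadd x (vscal t u))) (f x))) (mv (Df xb) u) =
  vscal (/ t) (vsub (vsub (f (vadd x (vscal t u))) (f x)) (vscal t (mv (Df xb) u))).
  by vext; lra.
have ti : 0 < / t by apply: Rinv_0_lt_compat.
rewrite n1Z Rabs_pos_eq; last lra.
by apply: (Rmult_le_reg_l t) => //; rewrite -Rmult_assoc Rinv_r; nra.
Qed.

(** Evaluating on a unit vector isolates one entry of the matrix. *)
Lemma mcv_of_unif m n (M : nat -> Mat m n) (L : Mat m n) :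
  (forall eps, 0 < eps -> eventually (fun k =>
     forall u, n1 (vsub (mv (M k) u) (mv L u)) <= eps * n1 u)) -> mcv M L.
Proof.
move=> H i j; apply/is_lim_seq_spec => eps.
have [e0 e1] : 0 < eps / 2 /\ eps / 2 < eps by have := cond_pos eps; lra.
apply: filter_imp (H _ e0) => k Hk; apply: Rle_lt_trans e1.
pose ej : Vec n := fun l => if l == j then 1 else 0.
have E p (A : Mat p n) l : mv A ej l = A l j.
  rewrite /mv (bigD1 j) //= /ej eqxx big1 => [|o /negbTE ->]; last by ring.
  by rewrite Rplus_0_r Rmult_1_r.
have ej1 : n1 ej = 1.
  rewrite /n1 (bigD1 j) //= /ej eqxx big1 => [|o /negbTE ->]; last by rewrite Rabs_R0.
  by rewrite Rabs_R1 Rplus_0_r.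
have := coord_le_n1 (vsub (mv (M k) ej) (mv L ej)) i.
by have := Hk ej; rewrite ej1 Rmult_1_r {2}/vsub !E; lra.
Qed.

Lemma strict_diff_mcv m n (f : Vec n -> Vec m) (Df : Vec n -> Mat m n) xb x :
  (forall x, hadamard f x (mv (Df x))) -> strict_diff f xb (Df xb) ->
  vcv x xb -> mcv (fun k => Df (x k)) (Df xb).
Proof.
move=> Hd Hs xl; apply: mcv_of_unif => eps eps0.
have [r [r0 H]] := strict_diff_deriv Df Hd Hs eps0.
by apply: filter_imp (vcv_eventually xl r0) => k /H.
Qed.

(** * Tangent and normal cones of a preimage under a map with surjective derivative *)

(** What the cone formulas require, with a single radius [r]. In [rp_solve] the corrections lie in
    the range of [B], a right inverse at [xb] that serves all nearby points [p]. *)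
Record regular_preimage m n (f : Vec n -> Vec m) (Df : Vec n -> Mat m n)
    (xb : Vec n) (Gam : Vec n -> Prop) (Th : Vec m -> Prop) (B : Mat n m) (r : R) : Prop := {
  rp_had : forall x, hadamard f x (mv (Df x));
  rp_inv : forall y, mv (Df xb) (mv B y) = y;
  rp_gt0 : 0 < r;
  rp_surj : forall x, n1 (vsub x xb) < r -> exists B', forall y, mv (Df x) (mv B' y) = y;
  rp_solve : forall p y, n1 (vsub p xb) < r -> n1 (vsub y (f p)) < r ->
    exists c, f (vadd p (mv B c)) = y /\ n1 c <= 2 * n1 (vsub y (f p));
  rp_loc : forall x, n1 (vsub x xb) < r -> (Gam x <-> Th (f x));
  rp_cont : forall x, vcv x xb -> mcv (fun k => Df (x k)) (Df xb) }.

Lemma regular_preimage_exists m n (f : Vec n -> Vec m) Df xb Gam Th :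
  (forall x, hadamard f x (mv (Df x))) -> strict_diff f xb (Df xb) ->
  (forall y, exists z, mv (Df xb) z = y) ->
  (exists r, 0 < r /\ forall x, n1 (vsub x xb) < r -> (Gam x <-> Th (f x))) ->
  exists B r, regular_preimage f Df xb Gam Th B r.
Proof.
move=> Hd Hs /surj_rinv [B AB] [r1 [r10 H1]].
have K0 := mnorm_ge0 B.
have e0 : 0 < / (2 * (mnorm B + 1)) by apply: Rinv_0_lt_compat; lra.
have [del [d0 Hdel]] := Hs _ e0.
have [r2 [r20 H2]] := strict_diff_deriv Df Hd Hs e0.
(* With [p] and [y] within [r3], the hypothesis of [graves] needs [r3 * (1 + 2 * mnorm B)] to be at
   most [del]. *)
pose r3 := del / (2 * (mnorm B + 1)).
have r30 : 0 < r3 by apply: Rmult_lt_0_compat.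
have r3E : r3 * (2 * (mnorm B + 1)) = del by rewrite /r3; field; lra.
pose r := Rmin r1 (Rmin r2 r3).
have [q1 [q2 q3]] : r <= r1 /\ r <= r2 /\ r <= r3.
  have := Rmin_l r1 (Rmin r2 r3); have := Rmin_r r1 (Rmin r2 r3).
  by have := Rmin_l r2 r3; have := Rmin_r r2 r3; rewrite -/r; lra.
exists B, r; split=> //.
- by do 2 apply: Rmin_pos => //.
- move=> x xr; apply: (perturb_surj AB) => u; apply: H2; lra.
- move=> p y pr yr; apply: (graves AB Hdel).
  by have := n1_ge0 (vsub y (f p)); nra.
- by move=> x xr; apply: H1; lra.
- by move=> x; apply: strict_diff_mcv.
Qed.

Lemma vscal_inv n t (x : Vec n) : 0 < t -> vscal t (vscal (/ t) x) = x.
Proof. by move=> t0; vext; lra. Qed.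

Lemma near_refl n (x : Vec n) r : 0 < r -> n1 (vsub x x) < r.
Proof. by rewrite (_ : vsub x x = vzero n) ?n1_0 //; vext. Qed.

(** The straight curve [x + t w] meets the prescribed values up to [t k * e k] with [e k] tending to
    zero. [rp_solve] removes this error by a correction of order [t k * n1 (e k)], which leaves the
    limit direction [w] unchanged. *)
Lemma lift_curve m n (f : Vec n -> Vec m) Df xb Gam Th B r :
  regular_preimage f Df xb Gam Th B r ->
  forall x t v w, n1 (vsub x xb) < r -> (forall k, 0 < t k) -> is_lim_seq t 0 ->
  vcv v (mv (Df x) w) -> exists u, vcv u w /\
    eventually (fun k => f (vadd x (vscal (t k) (u k))) = vadd (f x) (vscal (t k) (v k))).
Proof.
move=> rp x t v w xr t0 tl vl.
pose p k := vadd x (vscal (t k) w).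
pose e k := vsub (v k) (vscal (/ t k) (vsub (f (p k)) (f x))).
have el : vcv e (vzero m).
  rewrite -[vzero m](_ : vsub (mv (Df x) w) (mv (Df x) w) = _); last by vext.
  exact: vcvB vl (rp_had rp _ t0 tl (vcv_const w)).
pose y k := vadd (f x) (vscal (t k) (v k)).
have yE k : vsub (y k) (f (p k)) = vscal (t k) (e k).
  by have := t0 k; rewrite /y /e => tk; vext; lra.
have te : vcv (fun k => vscal (t k) (e k)) (vzero m).
  by rewrite (_ : vzero m = vscal 0 (vzero m)); [apply: vcvZ | vext].
have ev1 : eventually (fun k => exists c, f (vadd (p k) (mv B c)) = y k /\ n1 c <= 2 * (t k * n1 (e k))).
  apply: filter_imp (filter_and _ _ (step_near tl (vcv_const w) xr) (vcv_eventually te (rp_gt0 rp))) => k [H1 H2].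
  have [||c [Hc Hc2]] := rp_solve rp (p := p k) (y := y k) => //.
    by rewrite yE; rewrite (_ : vsub _ _ = vscal (t k) (e k)) in H2; last by vext.
  exists c; split=> //; move: Hc2; rewrite yE n1Z Rabs_pos_eq //.
  exact: Rlt_le.
have [c Hc] := eventually_choice (vzero m) _ ev1.
exists (fun k => vadd w (vscal (/ t k) (mv B (c k)))); split; last first.
  apply: filter_imp Hc => k [Hc _].
  rewrite -[RHS]Hc; congr f; have tk := t0 k; rewrite /p; vext; lra.
rewrite -[X in vcv _ X](_ : vadd w (vzero n) = w); last by vext.
apply: vcvD (vcv_const w) _; apply: vcv_n1.
apply: (is_lim_seq_le_le_loc (fun=> 0) _ (fun k => mnorm B * (2 * n1 (e k)))); last 2 first.
- exact: is_lim_seq_const.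
- have := is_lim_seq_mult' _ _ _ _ (is_lim_seq_const (mnorm B))
    (is_lim_seq_mult' _ _ _ _ (is_lim_seq_const 2) (cv_n1 el)).
  by rewrite n1_0 !Rmult_0_r.
apply: filter_imp Hc => k [_ Hc]; split; first exact: n1_ge0.
have tk := t0 k; have ti : 0 < / t k by apply: Rinv_0_lt_compat.
rewrite (_ : vsub _ _ = vscal (/ t k) (mv B (c k))); last by rewrite vsubE; vext.
rewrite n1Z Rabs_pos_eq; last lra.
apply: (Rmult_le_reg_l (t k)) => //; rewrite -Rmult_assoc Rinv_r; last lra.
by have := n1_mv B (c k); have := mnorm_ge0 B; nra.
Qed.

(** Difference quotients of [f] carry tangent sequences forward, and [lift_curve] carries them
    back. *)
Lemma Tc_preimage m n (f : Vec n -> Vec m) Df xb Gam Th B r :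
  regular_preimage f Df xb Gam Th B r ->
  forall x w, n1 (vsub x xb) < r -> (Tc Gam x w <-> Tc Th (f x) (mv (Df x) w)).
Proof.
move=> rp x w xr; split=> /TcP [t [u [t0 [tl [ul H]]]]].
  apply: (Tc_eventually _ _ t0 tl (rp_had rp _ t0 tl ul)).
  apply: filter_imp (step_near tl ul xr) => k Hk.
  rewrite vscal_inv // (_ : vadd (f x) _ = f (vadd x (vscal (t k) (u k)))); last by vext.
  exact/(rp_loc rp Hk).
have [u' [ul' Hu']] := lift_curve rp xr t0 tl ul.
apply: (Tc_eventually _ _ t0 tl ul').
apply: filter_imp (filter_and _ _ (step_near tl ul' xr) Hu') => k [Hk Ek].
by apply/(rp_loc rp Hk); rewrite Ek.
Qed.

(** Kernel directions of [Df x] are tangent to [Gam], so a normal is nonpositive on the kernel and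
    hence in the range of the transpose; surjectivity then transfers the polar inequality to
    [Th]. *)
Lemma Nc_preimage m n (f : Vec n -> Vec m) Df xb Gam Th B r :
  regular_preimage f Df xb Gam Th B r ->
  forall x xs, n1 (vsub x xb) < r ->
  (Nc Gam x xs <-> exists mu, Nc Th (f x) mu /\ xs = mtv (Df x) mu).
Proof.
move=> rp x xs xr; split=> [[Gx H]|[mu [[Tx H] ->]]].
  have Tx : Th (f x) by apply/(rp_loc rp xr).
  have [B' AB'] := rp_surj rp xr.
  have E : xs = mtv (Df x) (mtv B' xs).
    apply: ker_orth_range => // w Hw; apply: H; apply/(Tc_preimage rp w xr).
    by rewrite Hw; apply: Tc0.
  exists (mtv B' xs); split=> //; split=> // v Hv.
  rewrite dot_mtv; apply: H; apply/(Tc_preimage rp _ xr).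
  by rewrite AB'.
split; first exact/(rp_loc rp xr).
by move=> w /(Tc_preimage rp w xr) /H; rewrite dot_mtv.
Qed.

(** Stated for maps, to match the plain map [L] in [hadamard]. *)
Definition self_adjoint n (H : Vec n -> Vec n) := forall u w, dot w (H u) = dot (H w) u.

(** The difference quotient of [mtv (Df x) muk] splits into the variation of [Df] at the fixed
    multiplier [mu], which tends to [H u], and [mtv (Df x)] applied to the quotient [eta] of the
    multipliers. The main point is that [eta] converges. *)
Lemma Tcp_gph_preimage m n (f : Vec n -> Vec m) Df xb Gam Th B r mu H :
  regular_preimage f Df xb Gam Th B r ->
  hadamard (fun x => mtv (Df x) mu) xb H ->
  forall u us, Tcp (gphNc Gam) (xb, mtv (Df xb) mu) (u, us) <->
    exists eta, Tcp (gphNc Th) (f xb, mu) (mv (Df xb) u, eta) /\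
      us = vadd (H u) (mtv (Df xb) eta).
Proof.
move=> rp Hd u us; have xr := near_refl xb (rp_gt0 rp).
split=> [/TcpP [t [uk [usk [t0 [tl [ul [usl Hk]]]]]]]|[eta [/TcpP [t [v [etak [t0 [tl [vl [el Hk]]]]]]] ->]]].
  pose x k := vadd xb (vscal (t k) (uk k)).
  have xl : vcv x xb := vcv_step xb tl ul.
  have near := step_near tl ul xr.
  have ev1 : eventually (fun k => exists muk, Nc Th (f (x k)) muk /\
      vadd (mtv (Df xb) mu) (vscal (t k) (usk k)) = mtv (Df (x k)) muk).
    by apply: filter_imp near => k /(Nc_preimage rp) Hx; apply/Hx/Hk.
  have [muk Hmu] := eventually_choice (vzero m) _ ev1.
  pose eta k := vscal (/ t k) (vsub (muk k) mu).
  pose z k := vsub (usk k) (vscal (/ t k) (vsub (mtv (Df (x k)) mu) (mtv (Df xb) mu))).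
  have zl : vcv z (vsub us (H u)) by apply: vcvB => //; apply: Hd.
  have zE : eventually (fun k => mtv (Df (x k)) (eta k) = z k).
    apply: filter_imp Hmu => k [_ Hmu]; have tk := t0 k.
    rewrite /eta mtvZ vsubE mtvD mtvZ -Hmu /z; vext; lra.
  (* The only possible limit: the transpose of [B] is a left inverse of the transpose of [Df xb]. *)
  pose ze := mtv B (vsub us (H u)).
  have Dl : mcv (fun k => Df (x k)) (Df xb) by apply: (rp_cont rp).

  (* The transpose of [(Df (x k) - Df xb) B], that is, the deviation of the transpose of
     [Df (x k) B] from the identity; it tends to zero. *)
  pose N k : Mat m m := fun j i => mmul (Df (x k)) B i j - mmul (Df xb) B i j.
  have idE e : mtv (mmul (Df xb) B) e = e.
    by apply: dot_ext => a; rewrite dot_mtv mv_mmul (rp_inv rp).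
  have NE k e : mv (N k) e = vsub (mtv (mmul (Df (x k)) B) e) e.
    transitivity (vsub (mtv (mmul (Df (x k)) B) e) (mtv (mmul (Df xb) B) e)); last by rewrite idE.
    apply: functional_extensionality => j; rewrite mvE.
    change (dot (vsub ((mmul (Df (x k)) B)^~ j) ((mmul (Df xb) B)^~ j)) e =
      dot ((mmul (Df (x k)) B)^~ j) e - dot ((mmul (Df xb) B)^~ j) e).
    by rewrite vsubE dotDl dotZl; ring.
  have Nl : is_lim_seq (fun k => mnorm (N k)) 0.
    rewrite (_ : 0 = mnorm ((fun _ _ => 0) : Mat m m)); last first.
      by rewrite /mnorm big1 // => i _; exact: (n1_0 m).
    apply: is_lim_seq_rsum => i; apply: cv_n1 => j.
    have := is_lim_seq_minus' _ _ _ _ (cv_dot (Dl j) (vcv_const (B^~ i))) (is_lim_seq_const (mmul (Df xb) B j i)).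
    by rewrite Rminus_diag_eq.
  have etal : vcv eta ze.
    pose e k := vsub (mtv B (z k)) (mtv (mmul (Df (x k)) B) ze).
    have el : vcv e (vzero m).
      rewrite (_ : vzero m = vsub ze (mtv (mmul (Df xb) B) ze)); last by rewrite idE; vext.
      apply: vcvB.
        rewrite /ze; exact: (vcv_mtv (mcv_const B) zl).
      apply: (vcv_ext _ (fun k => esym (mtv_mmul (Df (x k)) B ze))).
      rewrite mtv_mmul; exact: (vcv_mtv (mcv_const B) (vcv_mtv Dl (vcv_const ze))).
    apply: vcv_n1; apply: (is_lim_seq_le_le_loc (fun=> 0) _ (fun k => 2 * n1 (e k))); last 2 first.
    - exact: is_lim_seq_const.
    - by have := is_lim_seq_mult' _ _ _ _ (is_lim_seq_const 2) (cv_n1 el); rewrite n1_0 Rmult_0_r.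
    have h0 : 0 < / 2 by lra.
    move/is_lim_seq_spec: Nl => /(_ (mkposreal _ h0)) Nl.
    apply: filter_imp (filter_and _ _ zE Nl) => k [zk /=].
    rewrite Rminus_0_r => /(Rle_lt_trans _ _ _ (Rle_abs _)) Nk.
    split; first exact: n1_ge0.
    set d := vsub (eta k) ze.
    (* Once [mnorm (N k)] is below one half, the term in [N k] is absorbed on the left, so [n1 d] is
       at most [2 * n1 (e k)]. This needs no prior bound on the multipliers. *)
    have dE : d = vsub (e k) (mv (N k) d).
      by rewrite NE /e -zk -mtv_mmul /d vsubE mtvD mtvZ; vext.
    have := n1B (e k) (mv (N k) d); rewrite -dE.
    by have := n1_mv (N k) d; have := n1_ge0 d; nra.
  exists ze; split.
    apply: (Tcp_eventually _ _ _ t0 tl (rp_had rp _ t0 tl ul) etal).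
    apply: filter_imp Hmu => k [Hmu _]; rewrite /gphNc /=.
    rewrite /eta !vscal_inv //.
    rewrite (_ : vadd mu _ = muk k); last by vext.
    rewrite -/(x k) (_ : vadd (f xb) _ = f (x k)) //; by vext.
  have E := vcv_unique (vcv_ext_loc _ zE (vcv_mtv Dl etal)) zl.
  by rewrite E; vext.
(* Conversely, lift the base curve and pull the multipliers [mu + t k * etak k] back at the lifted
   points. *)
have [uk [ul Hu]] := lift_curve rp xr t0 tl vl.
pose x k := vadd xb (vscal (t k) (uk k)).
have xl : vcv x xb := vcv_step xb tl ul.
have Dl : mcv (fun k => Df (x k)) (Df xb) by apply: (rp_cont rp).
apply: (Tcp_eventually _ _ _ t0 tl ul (vcvD (Hd _ _ _ t0 tl ul) (vcv_mtv Dl el))).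
apply: filter_imp (filter_and _ _ (step_near tl ul xr) Hu) => k [Hn Ek].
rewrite /gphNc /=; apply/(Nc_preimage rp _ Hn).
exists (vadd mu (vscal (t k) (etak k))); rewrite Ek; split; first exact: Hk.
have tk := t0 k; rewrite mtvD mtvZ -/(x k); vext; lra.
Qed.

(** Symmetry of [H] moves it from [u] to [w], so the polar condition reads
    [<ws + H w, u> + <Df w, eta> <= 0] whenever [(Df u, eta)] is tangent to the graph over [Th]. *)
Lemma Ncp_gph_preimage m n (f : Vec n -> Vec m) Df xb Gam Th B r mu H :
  regular_preimage f Df xb Gam Th B r ->
  hadamard (fun x => mtv (Df x) mu) xb H -> self_adjoint H -> Nc Th (f xb) mu ->
  forall ws w, Ncp (gphNc Gam) (xb, mtv (Df xb) mu) (ws, w) <->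
    exists us, Ncp (gphNc Th) (f xb, mu) (us, mv (Df xb) w) /\
      ws = vadd (vopp (H w)) (mtv (Df xb) us).
Proof.
move=> rp Hd adj Nmu ws w; have xr := near_refl xb (rp_gt0 rp).
have T := Tcp_gph_preimage rp Hd.
split=> [[_ HN]|[us [[_ HN] ->]]].
  have HN' u eta : Tcp (gphNc Th) (f xb, mu) (mv (Df xb) u, eta) ->
      dot (vadd ws (H w)) u + dot (mv (Df xb) w) eta <= 0.
    move=> Ht; have /HN : Tcp (gphNc Gam) (xb, mtv (Df xb) mu) (u, vadd (H u) (mtv (Df xb) eta)).
      by apply/T; exists eta.
    by rewrite /pdot /= dotDr adj dotDl [dot w (mtv _ _)]dotC dot_mtv [dot eta _]dotC; lra.
  (* For [u] in the kernel and [eta] zero, the tangent pair is the origin, so [ws + H w] is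
     nonpositive on the kernel. *)
  have E : vadd ws (H w) = mtv (Df xb) (mtv B (vadd ws (H w))).
    apply: ker_orth_range; first exact: rp_inv rp.
    move=> u Hu; have := HN' u (vzero m).
    rewrite Hu [dot _ (vzero m)]dotC dot0l Rplus_0_r; apply.
    exact: Tcp0.
  exists (mtv B (vadd ws (H w))); split; last by rewrite -E; vext.
  split=> // -[v eta] Ht; rewrite /pdot /= dot_mtv; apply: HN'.
  by rewrite (rp_inv rp).
split; first by apply/(Nc_preimage rp _ xr); exists mu.
move=> [u uss] /T [eta [/HN]]; rewrite /pdot /= => Hle ->.
rewrite dotDl vopp_scal dotZl dotDr adj [dot w (mtv _ _)]dotC !dot_mtv.
by rewrite [dot eta _]dotC; lra.
Qed.

(** * From Frechet derivatives to Hadamard and strict ones *)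

Lemma frechet_n1 m n (f : Vec n -> Vec m) x (A : Mat m n) : frechet f x A ->
  forall eps, 0 < eps -> exists del, 0 < del /\ forall y,
    n1 (vsub y x) < del -> lin_err f A y x <= eps * n1 (vsub y x).
Proof.
move=> H eps e0; have m0 := pos_INR m.
(* Passing from [vnorm] to [n1] in the target costs a factor [INR m]; the added one keeps the
   divisor positive when [m] is zero. *)
have e10 : 0 < eps / (INR m + 1) by apply: Rdiv_lt_0_compat; lra.
have [del [d0 Hd]] := H _ e10; exists del; split=> // y yd.
have := Hd y (Rle_lt_trans _ _ _ (vnorm_le_n1 _) yd).
set e1 := eps / _ in e10 * => H1.
have E : e1 * (INR m + 1) = eps by rewrite /e1; field; lra.
apply: Rle_trans (n1_le_vnorm _) _; have := vnorm_le_n1 (vsub y x) => H2.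
have : vnorm (vsub (vsub (f y) (f x)) (mv A (vsub y x))) <= e1 * n1 (vsub y x) by nra.
have := n1_ge0 (vsub y x); set N := n1 _ => N0; set M := vnorm _ => H3.
rewrite -E; have : INR m * M <= INR m * (e1 * N) by apply: Rmult_le_compat_l.
by nra.
Qed.

Lemma frechet_hadamard m n (f : Vec n -> Vec m) x (A : Mat m n) :
  frechet f x A -> hadamard f x (mv A).
Proof.
move=> H t u w t0 tl ul.
pose q k := vscal (/ t k) (vsub (f (vadd x (vscal (t k) (u k)))) (f x)).
suff L : vcv (fun k => vsub (q k) (mv A (u k))) (vzero m).
  have := vcvD L (vcv_mv (mcv_const A) ul).
  rewrite (_ : vadd (vzero m) _ = mv A w); last by vext.
  by move=> L2; apply: vcv_ext L2 => k; rewrite /q; vext.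
apply: vcv_n1; apply/is_lim_seq_spec => eps.
have w0 := n1_ge0 w.
(* Eventually [n1 (u k)] is at most [n1 w + 1]; the extra unit makes the final inequality strict. *)
have e10 : 0 < eps / (n1 w + 2) by apply: Rdiv_lt_0_compat; [apply: cond_pos | lra].
have [del [d0 Hd]] := frechet_n1 H e10.
have L1 := vcv_eventually ul Rlt_0_1.
apply: filter_imp (filter_and _ _ (step_near tl ul (near_refl x d0)) L1) => k [H1 H2].
have tk := t0 k; have ti : 0 < / t k by apply: Rinv_0_lt_compat.
rewrite Rminus_0_r Rabs_pos_eq; last exact: n1_ge0.
have := Hd _ H1; rewrite /lin_err.
have -> : vsub (vadd x (vscal (t k) (u k))) x = vscal (t k) (u k) by vext.
rewrite mvZ (_ : vsub (vsub _ _) _ = vscal (t k) (vsub (q k) (mv A (u k)))); last first.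
  by rewrite /q; vext; lra.
rewrite !n1Z Rabs_pos_eq; last lra.
rewrite (_ : vsub (vsub _ _) _ = vsub (q k) (mv A (u k))); last by vext.
move=> H3; have Hu : n1 (u k) <= n1 w + 1.
  have := n1D (vsub (u k) w) w; rewrite (_ : vadd _ _ = u k); [lra | by vext].
set e1 := eps / _ in e10 H3.
have E : e1 * (n1 w + 2) = eps by rewrite /e1; field; lra.
have : n1 (vsub (q k) (mv A (u k))) <= e1 * n1 (u k).
  by apply: (Rmult_le_reg_l (t k)) => //; lra.
by nra.
Qed.

Lemma finite_delta m n (x : Vec n) (P : 'I_m -> Vec n -> Prop) :
  (forall i, exists del, 0 < del /\ forall y, n1 (vsub y x) < del -> P i y) ->
  exists del, 0 < del /\ forall y, n1 (vsub y x) < del -> forall i, P i y.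
Proof.
move=> /functional_choice [del H].
have i0 i : 0 < / del i by apply: Rinv_0_lt_compat; case: (H i).
have S0 : 0 <= rsum m (fun i => / del i) by apply: rsum_ge0 => i; apply: Rlt_le.
(* This lies below every [del i] and remains positive for an empty index set. *)
exists (/ (1 + rsum m (fun i => / del i))); split.
  by apply: Rinv_0_lt_compat; lra.
move=> y yd i; case: (H i) => di; apply; apply: Rlt_le_trans yd _.
rewrite -[del i]Rinv_inv; apply: Rinv_le_contravar => //.
have := @rsum_ge_term _ (fun i => / del i) i (fun i => Rlt_le _ _ (i0 i)); lra.
Qed.

Lemma frechet_line m n (f : Vec n -> Vec m) b v s (A : Mat m n) i :
  frechet f (vadd b (vscal s v)) A ->
  derivable_pt_lim (fun s => f (vadd b (vscal s v)) i) s (mv A v i).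
Proof.
move=> H eps e0; have v0 := n1_ge0 v.
have e10 : 0 < eps / (n1 v + 1) by apply: Rdiv_lt_0_compat; lra.
have [del [d0 Hd]] := frechet_n1 H e10.
have d10 : 0 < del / (n1 v + 1) by apply: Rdiv_lt_0_compat; lra.
exists (mkposreal _ d10) => h h0 /= hd.
have E : vsub (vadd b (vscal (s + h) v)) (vadd b (vscal s v)) = vscal h v by vext.
have := Hd (vadd b (vscal (s + h) v)); rewrite /lin_err E n1Z mvZ.
set e1 := eps / _ in e10 *; set d1 := del / _ in d10 hd.
have Ee : e1 * (n1 v + 1) = eps by rewrite /e1; field; lra.
have Ed : d1 * (n1 v + 1) = del by rewrite /d1; field; lra.
have hp : 0 < Rabs h by apply: Rabs_pos_lt.
move=> /(_ ltac:(nra)) H1.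
have := Rle_trans _ _ _ (coord_le_n1 _ i) H1; rewrite /vsub /vscal => H2.
set F := f _ i in H2 *; set G := f _ i in H2 *; set L := mv A v i in H2 *.
rewrite (_ : (F - G) / h - L = (F - G - h * L) / h); last by field.
rewrite /Rdiv Rabs_mult Rabs_inv.
apply: (Rmult_lt_reg_r (Rabs h)) => //; rewrite Rmult_assoc Rinv_l; last lra.
by nra.
Qed.

Lemma mvBl m n (A B : Mat m n) x i : dot (vsub (A i) (B i)) x = mv A x i - mv B x i.
Proof. by rewrite vsubE dotDl dotZl !mvE; ring. Qed.

(** Differentiability of the rows of [Df] at [xb] makes [Df] continuous there; the mean value
    theorem along the segment from [b] to [a] then bounds each component of the error. *)
Lemma frechet_strict_diff m n (f : Vec n -> Vec m) (Df : Vec n -> Mat m n) xb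
    (D2 : 'I_m -> Mat n n) :
  (forall x, frechet f x (Df x)) -> (forall i, frechet (fun y => Df y i) xb (D2 i)) ->
  strict_diff f xb (Df xb).
Proof.
move=> Hf H2 eps e0; have m0 := pos_INR m.
have e10 : 0 < eps / (INR m + 1) by apply: Rdiv_lt_0_compat; lra.
set e1 := eps / _ in e10.
have E : e1 * (INR m + 1) = eps by rewrite /e1; field; lra.
have [del [d0 Hdel]] : exists del, 0 < del /\ forall y, n1 (vsub y xb) < del ->
    forall i, n1 (vsub (Df y i) (Df xb i)) <= e1.
  apply: finite_delta => i.
  have [d [d0 Hd]] := frechet_n1 (H2 i) Rlt_0_1.
  have M0 := mnorm_ge0 (D2 i); set M := mnorm _ in M0.
  exists (Rmin d (e1 / (1 + M))); split.
    by apply: Rmin_pos => //; apply: Rdiv_lt_0_compat; lra.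
  move=> y yd; have y1 := Rlt_le_trans _ _ _ yd (Rmin_l _ _).
  have y2 := Rlt_le_trans _ _ _ yd (Rmin_r _ _).
  have := lin_err_lip (Hd y y1); rewrite -/M.
  have : (e1 / (1 + M)) * (1 + M) = e1 by field; lra.
  set r := e1 / _ in y2 *; by nra.
exists del; split=> // a b an bn.
pose v := vsub a b.
rewrite /lin_err -/v -E; have v0 := n1_ge0 v.
suff H i : Rabs (vsub (vsub (f a) (f b)) (mv (Df xb) v) i) <= e1 * n1 v.
  by apply: Rle_trans (@n1_le _ _ (fun=> e1 * n1 v) H) _; rewrite rsum_const; nra.
pose p s := vadd b (vscal s v).
have p0 : p 0 = b by rewrite /p; vext.
have p1 : p 1 = a by rewrite /p /v; vext.
have D s : 0 <= s <= 1 -> derivable_pt_lim (fun s => f (p s) i - mv (Df xb) v i * s) s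
    (mv (Df (p s)) v i - mv (Df xb) v i * 1).
  move=> _; apply: derivable_pt_lim_minus; first exact: frechet_line.
  by apply: derivable_pt_lim_scal; apply: derivable_pt_lim_id.
have [s [Es s01]] := MVT_cor2 _ _ 0 1 Rlt_0_1 D.
rewrite p0 p1 in Es.
have -> : vsub (vsub (f a) (f b)) (mv (Df xb) v) i = mv (Df (p s)) v i - mv (Df xb) v i.
  by rewrite /vsub; lra.
rewrite -mvBl; apply: Rle_trans (dot_le _ _) _.
apply: Rmult_le_compat_r => //; apply: Hdel.
(* The ball is convex, so the intermediate point stays in it. *)
rewrite (_ : vsub (p s) xb = vadd (vscal (1 - s) (vsub b xb)) (vscal s (vsub a xb))); last first.
  by rewrite /p /v; vext.
have := n1D (vscal (1 - s) (vsub b xb)) (vscal s (vsub a xb)).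
by rewrite !n1Z !Rabs_pos_eq; nra.
Qed.

(** * Symmetry of second derivatives *)

(** The mean value theorem in [s], applied to [f (x + t w + s v) - f (x + s v)], gives [t] times a
    difference of first derivatives. Linearising both at [x] cancels the terms in [D2 v]. *)
Lemma second_difference m n (f : Vec n -> Vec m) (Df : Vec n -> Mat m n) x i (D2 : Mat n n) v w :
  (forall x, frechet f x (Df x)) -> frechet (fun y => Df y i) x D2 ->
  forall eps, 0 < eps -> exists del, 0 < del /\ forall t, 0 < t < del ->
   Rabs (f (vadd x (vadd (vscal t v) (vscal t w))) i - f (vadd x (vscal t v)) i
         - f (vadd x (vscal t w)) i + f x i - t * t * dot (mv D2 w) v) <= eps * (t * t).
Proof.
move=> Hf H2 eps e0.
have v0 := n1_ge0 v; have w0 := n1_ge0 w.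
(* The two linearisation errors add up to at most [e1 * C * t]; the mean value theorem supplies the
   other factor [t]. *)
pose C := (2 * n1 v + n1 w + 1) * (n1 v + 1).
have C0 : 0 < C by rewrite /C; nra.
have e10 : 0 < eps / C by apply: Rdiv_lt_0_compat.
have [d [d0 Hd]] := frechet_n1 H2 e10; set e1 := eps / C in e10 Hd.
have Ee : e1 * C = eps by rewrite /e1; field; lra.
pose S := n1 v + n1 w + 1; have S0 : 0 < S by rewrite /S; lra.
exists (d / S); split; first exact: Rdiv_lt_0_compat.
move=> t [t0 td].
have tS : t * S < d by apply: (Rmult_lt_reg_r (/ S)); [apply: Rinv_0_lt_compat | rewrite Rmult_assoc Rinv_r; lra].
have near s : 0 <= s <= t -> forall c, 0 <= c <= t ->
    let y := vadd (vadd x (vscal c w)) (vscal s v) in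
    Rabs (dot (Df y i) v - dot (Df x i) v - c * dot (mv D2 w) v - s * dot (mv D2 v) v)
      <= e1 * (c * n1 w + s * n1 v) * n1 v.
  move=> s0 c c0 y.
  have Ey : vsub y x = vadd (vscal c w) (vscal s v) by rewrite /y; vext.
  have N : n1 (vsub y x) <= c * n1 w + s * n1 v.
    by rewrite Ey; have := n1D (vscal c w) (vscal s v); rewrite !n1Z !Rabs_pos_eq; lra.
  have yd : n1 (vsub y x) < d.
    apply: Rle_lt_trans N _; apply: Rle_lt_trans tS; rewrite /S; nra.
  have := Hd y yd; rewrite /lin_err.
  have := dot_le (vsub (vsub (Df y i) (Df x i)) (mv D2 (vsub y x))) v.
  rewrite {1}Ey mvD !mvZ !vsubE !(dotDl, dotZl, mvE).
  rewrite -!vsubE => A1 A2.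
  have -> : dot (Df y i) v - dot (Df x i) v - c * dot (mv D2 w) v - s * dot (mv D2 v) v =
    dot (Df y i) v + -1 * dot (Df x i) v + -1 * (c * dot (mv D2 w) v + s * dot (mv D2 v) v) by ring.
  apply: Rle_trans A1 _; apply: Rmult_le_compat_r => //.
  by apply: Rle_trans A2 _; nra.
pose q c s := vadd (vadd x (vscal c w)) (vscal s v).
have D s : 0 <= s <= t -> derivable_pt_lim (fun s => f (q t s) i - f (q 0 s) i) s
    (mv (Df (q t s)) v i - mv (Df (q 0 s)) v i).
  by move=> _; apply: derivable_pt_lim_minus; apply: frechet_line.
have [s [Es s0t]] := MVT_cor2 _ _ 0 t t0 D.
have q1 : q t t = vadd x (vadd (vscal t v) (vscal t w)) by rewrite /q; vext.
have q2 : q t 0 = vadd x (vscal t w) by rewrite /q; vext.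
have q3 : q 0 t = vadd x (vscal t v) by rewrite /q; vext.
have q4 : q 0 0 = x by rewrite /q; vext.
rewrite q1 q2 q3 q4 Rminus_0_r in Es.
set a1 := f _ i in Es *; set a2 := f _ i in Es *; set a3 := f _ i in Es *.
set P1 := mv _ v i in Es; set P2 := mv _ v i in Es; set T := dot (mv D2 w) v.
have -> : a1 - a2 - a3 + f x i - t * t * T = (P1 - P2 - t * T) * t by lra.
rewrite Rabs_mult (Rabs_pos_eq t); last lra.
have N1 := near s ltac:(lra) t ltac:(lra); have N2 := near s ltac:(lra) 0 ltac:(lra).
rewrite /= -/(q t s) -/(q 0 s) in N1 N2.
change (dot (Df (q t s) i) v) with P1 in N1; change (dot (Df (q 0 s) i) v) with P2 in N2.
rewrite -/T in N1 N2; set U := dot (mv D2 v) v in N1 N2; set X := dot (Df x i) v in N1 N2.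
have K : Rabs (P1 - P2 - t * T) <= e1 * (t * n1 w + s * n1 v) * n1 v + e1 * (0 * n1 w + s * n1 v) * n1 v.
  have := Rabs_triang (P1 - X - t * T - s * U) (- (P2 - X - 0 * T - s * U)).
  rewrite Rabs_Ropp (_ : _ + - _ = P1 - P2 - t * T); [lra | ring].
have K2 : e1 * (t * n1 w + s * n1 v) * n1 v + e1 * (0 * n1 w + s * n1 v) * n1 v <= e1 * C * t.
  have -> : e1 * (t * n1 w + s * n1 v) * n1 v + e1 * (0 * n1 w + s * n1 v) * n1 v =
     e1 * ((t * n1 w + 2 * s * n1 v) * n1 v) by ring.
  rewrite (Rmult_assoc e1 C); apply: Rmult_le_compat_l; first lra.
  have A1 : t * n1 w + 2 * s * n1 v <= t * (2 * n1 v + n1 w + 1) by nra.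
  rewrite /C; have A2 : 0 <= t * n1 w + 2 * s * n1 v by nra.
  by nra.
by rewrite Ee in K2; nra.
Qed.

(** The second difference is unchanged when [v] and [w] are exchanged, so both bilinear values
    approximate the same number. *)
Lemma schwarz m n (f : Vec n -> Vec m) (Df : Vec n -> Mat m n) x i (D2 : Mat n n) :
  (forall x, frechet f x (Df x)) -> frechet (fun y => Df y i) x D2 -> self_adjoint (mv D2).
Proof.
move=> Hf H2 v w; rewrite dotC.
apply: cond_eq => eps e0.
have e40 : 0 < eps / 4 by lra.
have [d1 [d10 H]] := @second_difference _ _ _ Df x i D2 v w Hf H2 _ e40.
have [d2 [d20 H']] := @second_difference _ _ _ Df x i D2 w v Hf H2 _ e40.
pose t := Rmin d1 d2 / 2.
have := Rmin_pos _ _ d10 d20; have := Rmin_l d1 d2; have := Rmin_r d1 d2 => m1 m2 m3.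
have := H t ltac:(rewrite /t; lra); have := H' t ltac:(rewrite /t; lra).
rewrite (_ : vadd (vscal t w) (vscal t v) = vadd (vscal t v) (vscal t w)); last by vext.
have tt : 0 < t * t by rewrite /t; nra.
set a1 := f _ i; set a2 := f _ i; set a3 := f _ i; set a4 := f _ i.
set T1 := dot _ _; set T2 := dot _ _ => K1 K2.
have : Rabs (t * t * (T1 - T2)) <= eps / 2 * (t * t).
  by split_Rabs; nra.
rewrite Rabs_mult (Rabs_pos_eq (t * t)); last lra.
move=> K3; have : Rabs (T1 - T2) <= eps / 2.
  by apply: (Rmult_le_reg_l (t * t)) => //; lra.
by lra.
Qed.

Lemma mv_hess_lag n m (D2f : Vec n -> 'I_m -> 'I_n -> 'I_n -> R) lam x u j :
  mv (hess_lag D2f lam x) u j = rsum m (fun i => lam i * mv (D2f x i) u j).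
Proof.
rewrite /mv /hess_lag.
under eq_bigr => k _ do rewrite Rmult_comm big_distrr.
rewrite exchange_big; apply: eq_bigr => i _.
by rewrite [RHS]big_distrr; apply: eq_bigr => k _ /=; ring.
Qed.

Lemma dot_mv_hess_lag n m (D2f : Vec n -> 'I_m -> 'I_n -> 'I_n -> R) lam x u w :
  dot w (mv (hess_lag D2f lam x) u) = rsum m (fun i => lam i * dot w (mv (D2f x i) u)).
Proof.
rewrite /dot; under eq_bigr => j _ do rewrite mv_hess_lag big_distrr.
rewrite exchange_big; apply: eq_bigr => i _.
by rewrite [RHS]big_distrr; apply: eq_bigr => j _ /=; ring.
Qed.

Lemma C2_hadamard n m (f : Vec n -> Vec m) Df D2f x :
  C2_with f Df D2f -> hadamard f x (mv (Df x)).
Proof. by case=> H _; apply: frechet_hadamard. Qed.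

Lemma C2_strict_diff n m (f : Vec n -> Vec m) Df D2f x :
  C2_with f Df D2f -> strict_diff f x (Df x).
Proof.
by case=> H [H2 _]; apply: (@frechet_strict_diff _ _ f Df x (D2f x) H) => i; apply: H2.
Qed.

Lemma C2_hess_self_adjoint n m (f : Vec n -> Vec m) Df D2f lam x :
  C2_with f Df D2f -> self_adjoint (mv (hess_lag D2f lam x)).
Proof.
case=> H [H2 _] u w; rewrite [RHS]dotC !dot_mv_hess_lag; apply: eq_bigr => i _.
by rewrite (@schwarz _ _ f Df x i (D2f x i) H (H2 x i)) dotC.
Qed.

(** The quotient is the combination, with weights [lam i], of the quotients of the rows of [Df]. *)
Lemma C2_hess_hadamard n m (f : Vec n -> Vec m) Df D2f lam x :
  C2_with f Df D2f ->
  hadamard (fun y => mtv (Df y) lam) x (mv (hess_lag D2f lam x)).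
Proof.
case=> H [H2 _] t u w t0 tl ul j; rewrite mv_hess_lag.
apply: (is_lim_seq_ext (fun k => rsum m (fun i =>
  lam i * vscal (/ t k) (vsub (Df (vadd x (vscal (t k) (u k))) i) (Df x i)) j))).
  move=> k; rewrite /vscal /vsub /mtv.
  have -> : forall F G : 'I_m -> R, rsum m F - rsum m G = rsum m (fun i => F i + -1 * G i).
    by move=> F G; rewrite big_split -big_distrr /=; ring.
  by rewrite big_distrr; apply: eq_bigr => i _ /=; ring.
apply: is_lim_seq_rsum => i; apply: is_lim_seq_mult'; first exact: is_lim_seq_const.
exact: (frechet_hadamard (H2 x i) t0 tl ul).
Qed.

(** * Chain and product rules for the composite *)

(** The quotients of [g] are themselves a convergent sequence of directions for [h]; moving
    directions make the chain rule immediate. *)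
Lemma hadamard_comp n s d (g : Vec n -> Vec s) (h : Vec s -> Vec d) x G H :
  hadamard g x G -> hadamard h (g x) H -> hadamard (fun y => h (g y)) x (fun u => H (G u)).
Proof.
move=> Hg Hh t u w t0 tl ul.
have := Hh _ _ _ t0 tl (Hg _ _ _ t0 tl ul); apply: vcv_ext => k.
by rewrite vscal_inv // (_ : vadd (g x) _ = g (vadd x (vscal (t k) (u k)))) //; vext.
Qed.

Lemma strict_diff_lip n m (f : Vec n -> Vec m) x A : strict_diff f x A ->
  forall r, 0 < r -> exists del, 0 < del /\ forall y, n1 (vsub y x) < del -> n1 (vsub (f y) (f x)) < r.
Proof.
move=> /(_ 1 Rlt_0_1) [d [d0 H]] r r0; have A0 := mnorm_ge0 A.
have q0 : 0 < r / (1 + mnorm A) by apply: Rdiv_lt_0_compat; lra.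
exists (Rmin d (r / (1 + mnorm A))); split; first exact: Rmin_pos.
move=> y yd; have y1 := Rlt_le_trans _ _ _ yd (Rmin_l _ _).
have y2 := Rlt_le_trans _ _ _ yd (Rmin_r _ _).
have := lin_err_lip (H y x y1 (near_refl x d0)).
have : r / (1 + mnorm A) * (1 + mnorm A) = r by field; lra.
by set q := r / _ in q0 y2 *; nra.
Qed.

Lemma strict_diff_comp n s d (g : Vec n -> Vec s) (h : Vec s -> Vec d) x A C :
  strict_diff g x A -> strict_diff h (g x) C -> strict_diff (fun y => h (g y)) x (mmul C A).
Proof.
move=> Hg Hh eps e0; have A0 := mnorm_ge0 A; have C0 := mnorm_ge0 C.
set a0 := mnorm A in A0; set c0 := mnorm C in C0.
(* The error splits into that of [h] between [g a] and [g b], and [C] applied to that of [g]; each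
   receives half of [eps]. *)
have e10 : 0 < eps / (2 * (c0 + 1)) by apply: Rdiv_lt_0_compat; lra.
have e20 : 0 < eps / (2 * (a0 + 1)) by apply: Rdiv_lt_0_compat; lra.
have [d1 [d10 H1]] := Hg _ e10.
have [d2 [d20 H2]] := Hh _ e20.
have [d3 [d30 H3]] := Hg _ Rlt_0_1.
have [d4 [d40 H4]] := strict_diff_lip Hg d20.
exists (Rmin (Rmin d1 d3) d4); split; first by do 2 apply: Rmin_pos => //.
have := Rmin_l (Rmin d1 d3) d4; have := Rmin_r (Rmin d1 d3) d4.
have := Rmin_l d1 d3; have := Rmin_r d1 d3 => m1 m2 m3 m4 a b an bn.
have L := lin_err_lip (H3 a b ltac:(lra) ltac:(lra)).
have E1 := H1 a b ltac:(lra) ltac:(lra).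
have E2 := H2 (g a) (g b) (H4 a ltac:(lra)) (H4 b ltac:(lra)).
have T := n1D (vsub (vsub (h (g a)) (h (g b))) (mv C (vsub (g a) (g b))))
  (mv C (vsub (vsub (g a) (g b)) (mv A (vsub a b)))).
have K := n1_mv C (vsub (vsub (g a) (g b)) (mv A (vsub a b))).
rewrite (_ : vadd _ _ = vsub (vsub (h (g a)) (h (g b))) (mv (mmul C A) (vsub a b))) in T; last first.
  by rewrite mv_mmul [in X in vadd _ X]mvB; vext.
move: E1 E2; rewrite /lin_err -/a0 -/c0 in L K T *.
set e1 := eps / _ in e10 *; set e2 := eps / _ in e20 *.
have Q1 : e1 * (2 * (c0 + 1)) = eps by rewrite /e1; field; lra.
have Q2 : e2 * (2 * (a0 + 1)) = eps by rewrite /e2; field; lra.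
set X := n1 (vsub (vsub (g a) (g b)) _) in K *; set Y := n1 (vsub (g a) (g b)) in L *.
have := n1_ge0 (vsub a b); set N := n1 (vsub a b) in L * => N0 E1 E2.
apply: Rle_trans T _.
have P1 : c0 * X <= c0 * (e1 * N) by apply: Rmult_le_compat_l.
have P2 : e2 * Y <= e2 * ((1 + a0) * N) by apply: Rmult_le_compat_l; lra.
by nra.
Qed.

(** Product rule: the increment is [Dg] transposed at the moved point, applied to the increment of
    the multiplier, plus the increment of [Dg] transposed at the fixed multiplier [lam]. *)
Lemma mtv_comp_hadamard n s d (g : Vec n -> Vec s) (Dg : Vec n -> Mat s n) D2g
    (h : Vec s -> Vec d) (Dh : Vec s -> Mat d s) D2h x mu :
  C2_with g Dg D2g -> C2_with h Dh D2h ->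
  hadamard (fun y => mtv (mmul (Dh (g y)) (Dg y)) mu) x
    (fun u => vadd (mtv (Dg x) (mv (hess_lag D2h mu (g x)) (mv (Dg x) u)))
                   (mv (hess_lag D2g (mtv (Dh (g x)) mu) x) u)).
Proof.
move=> Cg Ch t u w t0 tl ul.
set lam := mtv (Dh (g x)) mu.
have Dl : mcv (fun k => Dg (vadd x (vscal (t k) (u k)))) (Dg x).
  apply: strict_diff_mcv (C2_strict_diff x Cg) (vcv_step x tl ul) => y.
  exact: C2_hadamard Cg.
have L1 := hadamard_comp (C2_hadamard x Cg) (C2_hess_hadamard (lam := mu) (x := g x) Ch) t0 tl ul.
have L2 := C2_hess_hadamard (lam := lam) (x := x) Cg t0 tl ul.
have := vcvD (vcv_mtv Dl L1) L2; apply: vcv_ext => k.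
by rewrite /= !mtv_mmul -/lam mtvZ vsubE mtvD mtvZ; vext.
Qed.

Theorem mainTheorem5 (n s d : nat)
  (g : Vec n -> Vec s) (Dg : Vec n -> Mat s n)
  (D2g : Vec n -> 'I_s -> 'I_n -> 'I_n -> R)
  (D : Vec s -> Prop) (xbar : Vec n)
  (Theta : Vec d -> Prop) (h : Vec s -> Vec d) (Dh : Vec s -> Mat d s)
  (D2h : Vec s -> 'I_d -> 'I_s -> 'I_s -> R) (V : Vec s -> Prop)
  (xstar : Vec n) (lam : Vec s) :
  (* g is C^2 with derivatives Dg, D2g; D closed; xbar \in Gamma = g^{-1}(D) *)
  C2_with g Dg D2g ->
  is_closed_set D ->
  D (g xbar) ->
  (* (A1) *)
  is_closed_set Theta ->
  C2_with h Dh D2h ->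
  nbhd V (g xbar) ->
  (forall y : Vec d, exists z : Vec s, mv (Dh (g xbar)) z = y) ->
  (forall z, V z -> (D z <-> Theta (h z))) ->
  (* (A2) *)
  (forall z : Vec s, exists (w : Vec n) (u : Vec s),
      mv (Dh (g xbar)) u = (fun _ => 0) /\ z = vadd (mv (Dg xbar) w) u) ->
  (* xstar \in \hat N_Gamma(xbar) *)
  Nc (fun x => D (g x)) xbar xstar ->
  (* lam is the (unique) multiplier *)
  Nc D (g xbar) lam ->
  mtv (Dg xbar) lam = xstar ->
  forall (wstar w : Vec n),
    Ncp (gphNc (fun x => D (g x))) (xbar, xstar) (wstar, w) <->
    exists vstar : Vec s,
      Ncp (gphNc D) (g xbar, lam) (vstar, mv (Dg xbar) w) /\
      wstar = vadd (vopp (mv (hess_lag D2g lam xbar) w)) (mtv (Dg xbar) vstar).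
Proof.
move=> Cg _ _ _ Ch [r [r0 rV]] surj DV A2 _ Nlam <- ws w.
(* The [n1] ball sits inside the Euclidean ball of the same radius. *)
have locD z : n1 (vsub z (g xbar)) < r -> (D z <-> Theta (h z)).
  by move=> zr; apply/DV/rV; apply: Rle_lt_trans (vnorm_le_n1 _) zr.
have [B [rD pD]] := regular_preimage_exists Dh D Theta (fun z => C2_hadamard z Ch)
  (C2_strict_diff (g xbar) Ch) surj (ex_intro _ r (conj r0 locD)).
(* One [mu], with [lam] equal to [mtv (Dh (g xbar)) mu], serves both for [D] and for its preimage
   under [g]. *)
have [mu [Nmu Elam]] := proj1 (Nc_preimage pD lam (near_refl _ (rp_gt0 pD))) Nlam.
pose Df x := mmul (Dh (g x)) (Dg x).
have hadf x : hadamard (fun x => h (g x)) x (mv (Df x)).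
  rewrite (_ : mv (Df x) = fun u => mv (Dh (g x)) (mv (Dg x) u)).
    exact: hadamard_comp (C2_hadamard x Cg) (C2_hadamard (g x) Ch).
  by apply: functional_extensionality => u; rewrite mv_mmul.
(* By (A2) a preimage of [y] under [Dh] can be corrected within the kernel of [Dh] to lie in the
   range of [Dg]. *)
have surjf y : exists z, mv (Df xbar) z = y.
  have [z <-] := surj y; have [v [u [Eu ->]]] := A2 z.
  by exists v; rewrite mv_mmul mvD Eu; vext.
have locG : exists r, 0 < r /\ forall x, n1 (vsub x xbar) < r -> (D (g x) <-> Theta (h (g x))).
  have [d0 [d00 H]] := strict_diff_lip (C2_strict_diff xbar Cg) r0.
  by exists d0; split=> // x /H; apply: locD.
have [B' [rG pG]] := regular_preimage_exists Df (fun x => D (g x)) Theta hadf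
  (strict_diff_comp (C2_strict_diff xbar Cg) (C2_strict_diff (g xbar) Ch)) surjf locG.
have adjh := C2_hess_self_adjoint mu (g xbar) Ch.
have adjg := C2_hess_self_adjoint lam xbar Cg.
have ND := Ncp_gph_preimage pD (C2_hess_hadamard (lam := mu) (x := g xbar) Ch) adjh Nmu.
have adjf : self_adjoint (fun u => vadd (mtv (Dg xbar) (mv (hess_lag D2h mu (g xbar)) (mv (Dg xbar) u)))
                   (mv (hess_lag D2g (mtv (Dh (g xbar)) mu) xbar) u)).
  move=> u v; rewrite -Elam dotDl dotDr adjg [dot v (mtv _ _)]dotC !(dot_mtv (Dg xbar)).
  by rewrite [dot (mv (hess_lag D2h _ _) (mv _ u)) _]dotC adjh.
have NG := Ncp_gph_preimage pG (mtv_comp_hadamard (x := xbar) (mu := mu) Cg Ch) adjf Nmu.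
rewrite /Df mtv_mmul -Elam in NG; rewrite -Elam in ND.
rewrite NG; split=> [[us [Hus ->]]|[vs [/ND [us [Hus ->]] ->]]].
  (* The formula for [D] dictates this witness; its Hessian term, pulled back by [Dg], is the first
     part of the Hessian of the composite. *)
  exists (vadd (vopp (mv (hess_lag D2h mu (g xbar)) (mv (Dg xbar) w))) (mtv (Dh (g xbar)) us)).
  split; first by apply/ND; exists us; rewrite -mv_mmul.
  by rewrite mtvD mtv_mmul !vopp_scal mtvZ; vext.
exists us; split; first by rewrite mv_mmul.
by rewrite mtvD mtv_mmul !vopp_scal mtvZ; vext.
Qed.
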